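(* Let $|\nu|<1/2$. If $f(t)$ is positive, increasing and integrable for $0<t<1$, then $$\operatorname{sgn}\left[\mathbb{H}_\nu(f)(j_{\nu,m})\right]=(-1)^{m+1},\qquad m=1,2,\dots.$$
   Context: $\nu$ is real. $J_\nu$ denotes the Bessel function of the first kind of order $\nu$, and $(j_{\nu,m})_{m\ge1}$ the sequence of all positive zeros of $J_\nu$ in ascending order. For $\nu>-1$, $\mathbb{J}_\nu(z)=\sum_{m=0}^\infty \frac{(-1)^m(z/2)^{2m}}{m!\,(\nu+1)_m}=\Gamma(\nu+1)(z/2)^{-\nu}J_\nu(z)$, where $(x)_m$ is the Pochhammer symbol, and $\mathbb{H}_\nu(f)(z)=\int_0^1 t^{\nu+1/2}f(t)\,\mathbb{J}_\nu(zt)\,dt$, $z\in\mathbb{C}$. *)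

(* Defs.v *)
From mathcomp Require Import all_boot all_order all_algebra.
From mathcomp Require Import all_classical all_reals all_analysis.
Set Implicit Arguments.
Unset Strict Implicit.
Unset Printing Implicit Defensive.
Import Order.TTheory GRing.Theory Num.Theory.
Import numFieldNormedType.Exports.
Local Open Scope classical_set_scope.
Local Open Scope ring_scope.

(* The Pochhammer symbol (x)_m = x (x + 1) ... (x + m - 1). *)
Definition pochhammer (R : realType) (x : R) (m : nat) : R :=
  \prod_(k < m) (x + k%:R).

(* 1 / Gamma(x), from Gauss's definition
   Gamma(x) = lim_n n! n^x / (x (x + 1) ... (x + n)).
   The reciprocal is used because it is defined for every real x: it
   vanishes at the poles 0, -1, -2, ... of Gamma. *)
Definition rgamma (R : realType) (x : R) : R :=
  limn (fun n : nat => pochhammer x n.+1 / (n`!%:R * n%:R `^ x)).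

(* J_nu(x) for real nu; meaningful only for x > 0 because of the real power
   (x / 2)^(2 m + nu). *)
Definition besselJ (R : realType) (nu x : R) : R :=
  limn (series (fun m : nat =>
    (-1) ^+ m / m`!%:R * rgamma (nu + m%:R + 1)
    * (x / 2) `^ (m.*2%:R + nu))).

(* The normalized Bessel function Gamma(nu + 1) (z / 2)^(-nu) J_nu(z),
   for nu > -1, given by its power series and restricted to real z. *)
Definition besselJJ (R : realType) (nu z : R) : R :=
  limn (series (fun m : nat =>
    (-1) ^+ m * (z / 2) ^+ m.*2 / (m`!%:R * pochhammer (nu + 1) m))).

Definition hankelH (R : realType) (nu : R) (f : R -> R) (z : R) : R :=
  (\int[lebesgue_measure]_(t in `]0, 1[)
     (t `^ (nu + 2^-1) * f t * besselJJ nu (z * t)))%R.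

(* (j m) for m >= 1 is the sequence of all positive zeros of F in ascending
   order; the value j 0 is irrelevant. *)
Definition ascending_positive_zeros (R : realType) (F : R -> R)
    (j : nat -> R) : Prop :=
  (forall m n : nat, (1 <= m)%N -> (m < n)%N -> j m < j n) /\
  (forall x : R, (0 < x /\ F x = 0) <-> (exists2 m : nat, (1 <= m)%N & j m = x)).

(* Main.v *)
Require Import Defs.
From mathcomp Require Import all_boot all_order all_algebra.
From mathcomp Require Import all_classical all_reals all_analysis.
From mathcomp Require Import measurable_realfun ring lra.
Import Order.TTheory GRing.Theory Num.Theory.
Import numFieldNormedType.Exports.
Local Open Scope classical_set_scope.
Local Open Scope ring_scope.

(** Put [z = j_(nu,m)] and [g(t) = t^(nu+1/2) JJ_nu(z t)], so that the transform
    is the integral of [f g] over (0,1).  Bessel's equation becomes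
    [g'' = - Q g] with [Q(t) = z^2 + (1/4 - nu^2) / t^2], which is positive and
    decreasing precisely because [|nu| < 1/2].  Reflecting a half-wave of [g]
    about its right end and comparing it with the next half-wave (Sturm), the
    latter is everywhere larger in absolute value and at least as long, so the
    areas of the half-waves increase.  As [f] increases too, the integrals of
    [|f g|] over the successive half-waves increase, hence their alternating sum
    has the sign of its last term. *)

(** * Elementary facts on real derivatives *)

Section RealFunctions.
Context {R : realType}.
Implicit Types (f df : R -> R) (a b x y : R).

Lemma is_derive1_continuous f x a : is_derive x 1 f a -> {for x, continuous f}.
Proof. by move=> [df _]; apply/differentiable_continuous/derivable1_diffP. Qed.

Lemma is_derive_gt0_lt {f} df {a b} : a < b ->
  (forall x, a < x < b -> is_derive x 1 f (df x)) ->
  (forall x, a <= x <= b -> {for x, continuous f}) ->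
  (forall x, a < x < b -> 0 < df x) -> f a < f b.
Proof.
move=> ab dfE cf df0.
have cf' : {within `[a, b], continuous f}.
  by apply: continuous_in_subspaceT => x; rewrite inE /= in_itv; exact: cf.
have dfE' x : x \in `]a, b[ -> is_derive x 1 f (df x).
  by rewrite in_itv; exact: dfE.
have [c] := MVT ab dfE' cf'.
rewrite in_itv /= => cab fE; rewrite -subr_gt0 fE mulr_gt0 ?subr_gt0//.
exact: df0.
Qed.

(** Carathéodory's slope function is continuous and positive at [a], hence positive just to the
    right of [a]. *)
Lemma is_derive_gt0_right {f a d} : is_derive a 1 f d -> f a = 0 -> 0 < d ->
  forall b, a < b -> exists2 y, a < y < b & 0 < f y.
Proof.
move=> /is_derive1_caratheodory[g [fE cg gad]] fa0 d0 b ab.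
have : \forall y \near a^'+, 0 < g y.
  by apply: (cvgr_gt (g a)); [exact: cvg_at_right_filter | rewrite gad].
move=> g0; near (a^'+) => y; exists y.
  by apply/andP; split; near: y; [exact: nbhs_right_gt | exact: nbhs_right_lt].
have := fE y; rewrite fa0 subr0 => ->; apply: mulr_gt0.
  by near: y.
by rewrite subr_gt0; near: y; exact: nbhs_right_gt.
Unshelve. all: by end_near. Qed.

Lemma is_derive_reflect {f a x d} : is_derive (a - x) 1 f d ->
  is_derive x 1 (fun t => f (a - t)) (- d).
Proof.
move=> dfd; rewrite -mulrN1 -[-1]add0r.
exact: (is_derive1_comp (g := cst a - id)).
Qed.

Lemma is_derive_translate {f a x d} : is_derive (a + x) 1 f d ->
  is_derive x 1 (fun t => f (a + t)) d.
Proof.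
move=> dfd; rewrite -[d]mulr1 -[X in _ * X]add0r.
exact: (is_derive1_comp (g := cst a + id)).
Qed.

End RealFunctions.

(** * Sturm comparison for the equation g'' = - Q g *)

Definition sturm_solution {R : realType} (Q g g1 : R -> R) :=
  forall x : R, 0 < x -> is_derive x 1 g (g1 x) /\ is_derive x 1 g1 (- (Q x * g x)).

(** The equation is linear. The factor will be (-1)^k, which turns every half-wave into a positive
    one. *)
Lemma sturm_solutionZ {R : realType} {Q g g1 : R -> R} k :
  sturm_solution Q g g1 ->
  sturm_solution Q (fun x => k * g x) (fun x => k * g1 x).
Proof.
move=> sol x x0; have [dg dg1] := sol x x0; split.
  exact: (is_deriveZ k).
rewrite mulrCA -mulrN; exact: (is_deriveZ k).
Qed.

Section Sturm.
Context {R : realType} {Q g g1 : R -> R}.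
Hypothesis sol : sturm_solution Q g g1.
Hypothesis Q_gt0 : forall x : R, 0 < x -> 0 < Q x.
Hypothesis Q_decr : forall x y : R, 0 < x -> x < y -> Q y < Q x.

Let dg (x : R) (x0 : 0 < x) : is_derive x 1 g (g1 x) := (sol x x0).1.
Let dg1 (x : R) (x0 : 0 < x) : is_derive x 1 g1 (- (Q x * g x)) := (sol x x0).2.

Lemma sturm_continuous (x : R) : 0 < x -> {for x, continuous g}.
Proof. by move=> /dg; exact: is_derive1_continuous. Qed.

(* A positive solution is concave, so it cannot reach zero horizontally. *)
Lemma sturm_slope_lt0 (c a : R) : 0 <= c -> c < a -> g a = 0 ->
  (forall x, c < x < a -> 0 < g x) -> g1 a < 0.
Proof.
move=> c0 ca ga0 gpos; rewrite ltNge; apply/negP => g1a.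
have g1pos x : c < x < a -> 0 < g1 x.
  move=> /andP[cx xa]; apply: le_lt_trans g1a _; rewrite -ltrN2.
  apply: (is_derive_gt0_lt (f := - g1) (fun t => Q t * g t) xa).
  - move=> y /andP[xy ya]; have y0 : 0 < y by lra.
    by rewrite -[Q y * g y]opprK; apply: is_deriveN; exact: dg1.
  - move=> y /andP[xy ya]; apply: continuousN.
    by apply: is_derive1_continuous; apply: dg1; lra.
  - move=> y /andP[xy ya]; rewrite mulr_gt0//; first by apply: Q_gt0; lra.
    by apply: gpos; lra.
have gm : 0 < g ((c + a) / 2) by apply: gpos; lra.
suff : g ((c + a) / 2) < g a by lra.
apply: (is_derive_gt0_lt g1); first lra.
- by move=> y y_; apply: dg; lra.
- by move=> y y_; apply: sturm_continuous; lra.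
- by move=> y y_; apply: g1pos; lra.
Qed.

(** The negative slope makes [g] negative just after [a]; a later value >= 0 would force a zero in
    between. *)
Lemma sturm_sign_lt0 (a b : R) : 0 < a -> g a = 0 -> g1 a < 0 ->
  (forall x, a < x < b -> g x != 0) -> forall x, a < x < b -> g x < 0.
Proof.
move=> a0 ga0 g1a gneq x /andP[ax xb].
have [y /andP[ay yx]] : exists2 y, a < y < x & 0 < - g y.
  apply: (is_derive_gt0_right (f := - g) (d := - g1 a)) => //.
  - by apply: is_deriveN; exact: dg.
  - by rewrite fctE ga0 oppr0.
  - by rewrite oppr_gt0.
rewrite oppr_gt0 => gy; rewrite ltNge; apply/negP => gx.
have cg : {within `[y, x], continuous g}.
  apply: continuous_in_subspaceT => z; rewrite inE /= in_itv /= => z_.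
  by apply: sturm_continuous; lra.
have [|z] := IVT (v := 0) (ltW yx) cg.
  by rewrite ge_min le_max (ltW gy) gx orbT.
rewrite in_itv /= => z_ gz; have : g z != 0 by apply: gneq; lra.
by rewrite gz eqxx.
Qed.

(* Sturm comparison of the two half-waves adjacent to [a], reflected onto each
   other: [y2 / y1] has positive derivative because the Wronskian does. *)
Lemma sturm_reflection (c a b s : R) : 0 <= c -> c < a -> g a = 0 ->
  (forall x, c < x < a -> 0 < g x) -> (forall x, a < x < b -> g x < 0) ->
  0 < s -> s < a - c -> s < b - a -> g (a - s) + g (a + s) < 0.
Proof.
move=> c0 ca ga0 gpos gneg s0 sl sr.
have g1a := sturm_slope_lt0 c a c0 ca ga0 gpos.
pose y1 t := g (a - t); pose y2 t := - g (a + t).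
pose z1 t := - g1 (a - t); pose z2 t := - g1 (a + t).
pose L (t : R) := 0 <= t <= s.
have dy1 t : L t -> is_derive t 1 y1 (z1 t).
  by move=> /andP[t0 ts]; apply: is_derive_reflect; apply: dg; lra.
have dy2 t : L t -> is_derive t 1 y2 (z2 t).
  move=> /andP[t0 ts]; apply: (is_deriveN (f := fun u => g (a + u))).
  by apply: is_derive_translate; apply: dg; lra.
have dz1 t : L t -> is_derive t 1 z1 (- (Q (a - t) * y1 t)).
  move=> /andP[t0 ts]; apply: (is_deriveN (f := fun u => g1 (a - u))).
  rewrite -[Q _ * _]opprK; apply: is_derive_reflect; apply: dg1; lra.
have dz2 t : L t -> is_derive t 1 z2 (- (Q (a + t) * y2 t)).
  move=> /andP[t0 ts]; rewrite /y2 mulrN.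
  apply: (is_deriveN (f := fun u => g1 (a + u))).
  by apply: is_derive_translate; apply: dg1; lra.
have y1pos t : 0 < t -> t <= s -> 0 < y1 t.
  by move=> t0 ts; apply: gpos; lra.
have y2pos t : 0 < t -> t <= s -> 0 < y2 t.
  by move=> t0 ts; rewrite oppr_gt0; apply: gneg; lra.
(* The Wronskian vanishes at 0, where [y1] and [y2] do, and its derivative (Q(a-u) - Q(a+u)) y1 y2
   is positive because [Q] decreases. *)
pose W t := y1 t * z2 t - z1 t * y2 t.
have Wpos t : 0 < t -> t <= s -> 0 < W t.
  move=> t0 ts; have <- : W 0 = 0.
    by rewrite /W /y1 /y2 addr0 subr0 ga0 oppr0 mulr0 mul0r subrr.
  have dW u : L u -> is_derive u 1 W ((Q (a - u) - Q (a + u)) * (y1 u * y2 u)).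
    move=> Lu; pose h1 := dy1 u Lu; pose h2 := dy2 u Lu.
    pose h3 := dz1 u Lu; pose h4 := dz2 u Lu.
    apply: is_derive_eq; rewrite /GRing.scale /=; ring.
  apply: (is_derive_gt0_lt (fun u => (Q (a - u) - Q (a + u)) * (y1 u * y2 u)) t0).
  - by move=> u u_; apply: dW; rewrite /L; lra.
  - by move=> u u_; apply: is_derive1_continuous; apply: dW; rewrite /L; lra.
  - move=> u u_; rewrite !mulr_gt0 ?y1pos ?y2pos ?subr_gt0 ?Q_decr//; lra.
pose r t := y2 t / y1 t.
have r_incr u v : 0 < u -> u < v -> v <= s -> r u < r v.
  have dr t : 0 < t -> t <= s -> is_derive t 1 r (W t / y1 t ^+ 2).
    move=> t0 ts; have Lt : L t by rewrite /L; lra.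
    have y1n : y1 t != 0 by rewrite gt_eqF// y1pos.
    pose h1 := dy1 t Lt; pose h2 := dy2 t Lt; pose h3 := is_deriveV y1n h1.
    apply: is_derive_eq; rewrite /GRing.scale /= /W; field.
    by [].
  move=> u0 uv vs; apply: (is_derive_gt0_lt (fun t => W t / y1 t ^+ 2) uv).
  - by move=> x x_; apply: dr; lra.
  - by move=> x x_; apply: is_derive1_continuous; apply: dr; lra.
  - by move=> x x_; rewrite divr_gt0 ?exprn_gt0 ?Wpos ?y1pos//; lra.
suff : 1 < r s.
  rewrite ltr_pdivlMr ?y1pos// mul1r /y1 /y2; lra.
rewrite ltNge; apply/negP => rs.
(* An intermediate value of the increasing ratio: strictly below 1, yet above [r] on all of (0,
   s/2). *)
pose k := r (s / 2); have k1 : k < 1.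
  by apply: lt_le_trans rs; apply: r_incr; lra.
(* Otherwise [y2 - k y1 < 0] near [0] although its slope at [0] is positive. *)
have dh : is_derive (0 : R) 1 (fun t => y2 t - k * y1 t) (z2 0 - k * z1 0).
  have L0 : L 0 by rewrite /L; lra.
  by pose h1 := dy1 0 L0; pose h2 := dy2 0 L0; apply: is_derive_eq.
have h0 : y2 0 - k * y1 0 = 0.
  by rewrite /y1 /y2 addr0 subr0 ga0 oppr0 mulr0 subrr.
have hp : 0 < z2 0 - k * z1 0.
  by rewrite /z1 /z2 addr0 subr0 mulrN opprK; nra.
have s2 : 0 < s / 2 by lra.
have [t t_] := is_derive_gt0_right dh h0 hp _ s2.
have : r t < k by apply: r_incr; lra.
rewrite ltr_pdivrMr ?y1pos//; lra.
Qed.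

(** Folded at [a], the positive half-wave on (c, a) lies below the absolute value of the negative
    one on (a, b), so it encloses less area. The primitive [G] measures both areas at once. *)
Lemma sturm_area (G : R -> R) (c a b : R) : 0 <= c -> c < a -> a < b ->
  (forall x : R, 0 < x -> is_derive x 1 G (g x)) ->
  (forall x : R, 0 <= x -> {for x, continuous G}) ->
  g a = 0 -> g b = 0 ->
  (forall x, c < x < a -> 0 < g x) -> (forall x, a < x < b -> g x < 0) ->
  G b < G c.
Proof.
move=> c0 ca ab dG cG ga0 gb0 gpos gneg.
have refl s := sturm_reflection c a b s c0 ca ga0 gpos gneg.
(* If the right half-wave were shorter, the folded sum at s = b - a would be the value of [g] inside
   (c, a), hence positive; by continuity it would be positive just before, against [refl]. *)
have lcb : a - c <= b - a.
  rewrite leNgt; apply/negP => ba.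
  pose D t := g (a - t) + g (a + t).
  have D0 : 0 < D (b - a).
    by rewrite /D addrC (addrC a) subrK gb0 add0r; apply: gpos; lra.
  have cD : {for (b - a), continuous D}.
    apply: (is_derive1_continuous _ _ (- g1 (a - (b - a)) + g1 (a + (b - a)))).
    apply: is_deriveD; [apply: is_derive_reflect|apply: is_derive_translate];
      apply: dg; lra.
  have Dpos : \forall t \near (b - a)^'-, 0 < D t.
    by apply: (cvgr_gt (D (b - a))) => //; exact: cvg_at_left_filter.
  near (b - a)^'- => t.
  have : 0 < D t by near: t.
  have t1 : t < b - a by near: t; exact: nbhs_left_lt.
  have t0 : 0 < t by near: t; apply: nbhs_left_gt; lra.
  by rewrite /D; have := refl t; lra.
(* Integrates the folded inequality over (0, a - c). Only continuity of [G] is used at the ends, so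
   c = 0 is covered. *)
have Gc : G (a + (a - c)) < G c.
  pose P t := G (a - t) - G (a + t).
  have : P 0 < P (a - c).
    apply: (is_derive_gt0_lt (fun t => - g (a - t) - g (a + t))).
    - lra.
    - by move=> x x_; apply: is_deriveB; [apply: is_derive_reflect|
        apply: is_derive_translate]; apply: dG; lra.
    - move=> x x_; apply: continuousB; apply: continuous_comp;
        try (apply: cG; lra); [apply: continuousB|apply: continuousD];
        by [exact: cvg_cst | exact: cvg_id].
    - by move=> x x_; have := refl x; lra.
  by rewrite /P addr0 subr0 subrr opprB (addrC a (c - a)) subrK subr_gt0.
(* What remains of the right half-wave beyond the mirror image of [c] only adds negative area. *)
apply: le_lt_trans Gc.
have [->|ne] := eqVneq b (a + (a - c)); first by [].
have lt : a + (a - c) < b by rewrite lt_neqAle eq_sym ne; lra.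
rewrite -lerN2; apply: ltW.
apply: (is_derive_gt0_lt (f := - G) (fun t => - g t) lt).
- by move=> x x_; apply: is_deriveN; apply: dG; lra.
- by move=> x x_; apply: continuousN; apply: cG; lra.
- by move=> x x_; rewrite oppr_gt0 gneg; lra.
Unshelve. all: by end_near. Qed.

End Sturm.

(** * Power series dominated by an exponential series *)

Section EntireSeries.
Context {R : realType}.
Implicit Types c : R^nat.

(** Comparison with C exp(A x): this gives convergence everywhere and survives termwise
    differentiation. *)
Definition exp_dominated c :=
  exists C A : R, 0 <= A /\ forall n, `|c n| <= C * (A ^+ n / n`!%:R).

(** Since (n+1)/(n+1)! = 1/n!, the same [A] serves and [C] becomes C A. *)
Lemma exp_dominated_diffs c : exp_dominated c -> exp_dominated (pseries_diffs c).
Proof.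
move=> [C [A [A0 cA]]]; exists (C * A), A; split=> // n.
rewrite /pseries_diffs normrM ger0_norm//.
apply: le_trans (ler_wpM2l (ler0n _ _) (cA n.+1)) _.
rewrite factS natrM exprS le_eqVlt; apply/orP; left; apply/eqP.
have h1 : n`!%:R != 0 :> R by rewrite pnatr_eq0 -lt0n fact_gt0.
have h2 : n.+1%:R != 0 :> R by rewrite pnatr_eq0.
by field; rewrite h1 nat1r h2.
Qed.

Lemma exp_dominated_cvg c x : exp_dominated c -> cvgn (pseries c x).
Proof.
move=> [C [A [A0 cA]]]; apply: normed_cvg.
have C0 : 0 <= C.
  apply: le_trans (normr_ge0 (c 0%N)) _.
  by have := cA 0%N; rewrite expr0 fact0 divr1 mulr1.
apply: (@series_le_cvg _ _ (C *: exp_coeff (A * `|x|))).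
- by move=> n; rewrite normr_ge0.
- by move=> n; rewrite mulr_ge0// divr_ge0// exprn_ge0// mulr_ge0.
- move=> n; rewrite /= normrM normrX.
  apply: le_trans (ler_wpM2r (exprn_ge0 n (normr_ge0 x)) (cA n)) _.
  by rewrite /exp_coeff /= fctE /GRing.scale /= exprMn; lra.
- by apply: is_cvg_seriesZ; exact: is_cvg_series_exp_coeff.
Qed.

Lemma exp_dominated_derive c (x : R) : exp_dominated c ->
  is_derive x 1 (fun t => limn (pseries c t)) (limn (pseries (pseries_diffs c) x)).
Proof.
(* Any radius above |x| would do; termwise differentiation asks for convergence there of the series
   and its first two derived series. *)
move=> dc; apply: (@pseries_snd_diffs _ c (`|x| + 1)).
- exact: exp_dominated_cvg.
- by apply: exp_dominated_cvg; exact: exp_dominated_diffs.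
- by apply: exp_dominated_cvg; do 2!apply: exp_dominated_diffs.
- by rewrite [ltRHS]ger0_norm ?ltrDl// addr_ge0.
Qed.

End EntireSeries.

(** * The reciprocal Gamma function through Gauss's limit *)

Section ReciprocalGamma.
Context {R : realType}.

Lemma pochhammerS (x : R) m : pochhammer x m.+1 = pochhammer x m * (x + m%:R).
Proof. by rewrite /pochhammer big_ord_recr. Qed.

Lemma pochhammer_gt0 (x : R) m : 0 < x -> 0 < pochhammer x m.
Proof. by move=> x0; apply: prodr_gt0 => i _; rewrite ltr_wpDr. Qed.

Lemma pochhammer_ge (x : R) m : 2^-1 <= x -> 2^-1 ^+ m <= pochhammer x m.
Proof.
move=> x2; elim: m => [|m IH]; first by rewrite /pochhammer big_ord0.
rewrite pochhammerS exprSr ler_pM ?exprn_ge0 ?invr_ge0//.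
by rewrite (le_trans x2)// lerDl.
Qed.

Definition gauss_rgamma (x : R) (n : nat) := pochhammer x n.+1 / (n`!%:R * n%:R `^ x).

(** With N = n+2 the ratio of consecutive terms is (1 + x/N)(1 - 1/N)^x <= exp(x/N) exp(-x/N) = 1.
    The start at index 1 matters: the term of index 0 is 0, by division by 0^x = 0. *)
Lemma gauss_rgamma_noninc (x : R) n : 0 < x -> gauss_rgamma x n.+2 <= gauss_rgamma x n.+1.
Proof.
move=> x0; rewrite /gauss_rgamma pochhammerS (factS n.+1) natrM.
set N : R := n.+2%:R; have N0 : 0 < N by rewrite ltr0n.
set M : R := n.+1%:R; have M0 : 0 < M by rewrite ltr0n.
have NM : N = M + 1 by rewrite natr1.
clearbody N M.
have f0 : 0 < (n.+1)`!%:R :> R by rewrite ltr0n fact_gt0.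
have p0 : 0 < pochhammer x n.+2 by exact: pochhammer_gt0.
have Mx : M `^ x = N `^ x * (M / N) `^ x.
  by rewrite -powRM ?divr_ge0 ?ltW// mulrCA divff ?mulr1 ?gt_eqF.
have q : (x + N) / N * (M / N) `^ x <= 1.
  have -> : (x + N) / N = 1 + x / N by field; rewrite gt_eqF.
  rewrite /powR gt_eqF ?divr_gt0//.
  apply: le_trans (ler_pM _ (expR_ge0 _) (expR_ge1Dx (x / N)) (lexx _)) _.
    by rewrite addr_ge0// divr_ge0 ?ltW.
  rewrite -expRD -[leRHS]expR0 ler_expR.
  have : ln (M / N) <= - N^-1.
    have -> : M / N = 1 + - N^-1.
      by rewrite (_ : M = N - 1) ?NM ?addrK//; field; rewrite -NM gt_eqF.
    by apply: le_ln1Dx; rewrite ltrN2 invf_lt1// NM ltrDr.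
  by move=> /(ler_wpM2l (ltW x0)); lra.
rewrite -mulrA ler_pM2l//.
have Nx : 0 < N `^ x by rewrite powR_gt0.
have Mx0 : 0 < M `^ x by rewrite powR_gt0.
rewrite ler_pdivrMr ?mulr_gt0// mulrC ler_pdivlMr ?mulr_gt0//.
rewrite {1}Mx; have := ler_wpM2l (ltW (mulr_gt0 (mulr_gt0 N0 f0) Nx)) q.
rewrite mulr1; apply: le_trans; rewrite le_eqVlt; apply/orP; left; apply/eqP.
by field; rewrite gt_eqF.
Qed.

(** Eventually nonincreasing and bounded below by 0, so the [limn] in [rgamma] is a true limit. *)
Lemma gauss_rgamma_cvg (x : R) : 0 < x -> gauss_rgamma x @ \oo --> rgamma x.
Proof.
move=> x0; suff : cvgn (gauss_rgamma x) by [].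
have cv : cvgn (fun n => gauss_rgamma x n.+1).
  apply: nonincreasing_is_cvgn.
    by apply/nonincreasing_seqP => n; exact: gauss_rgamma_noninc.
  exists 0 => _ [n _ <-]; apply: divr_ge0; first by rewrite ltW// pochhammer_gt0.
  by rewrite mulr_ge0// powR_ge0.
by apply/cvg_ex; move/cvg_ex : cv => [l]; rewrite cvg_shiftS => ?; exists l.
Qed.

(** The terms for x + 1 are those for x times (1 + (x+1)/(n+1))/x, a factor tending to 1/x. *)
Lemma rgammaS (x : R) : 0 < x -> rgamma (x + 1) = rgamma x / x.
Proof.
move=> x0.
have h : (fun n => gauss_rgamma x n.+1 * ((1 + (x + 1) * harmonic n) / x)) @ \oo -->
    rgamma x * ((1 + (x + 1) * 0) / x).
  apply: cvgM; first by rewrite cvg_shiftS; exact: gauss_rgamma_cvg.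
  apply: cvgMr_tmp; apply: cvgD; first exact: cvg_cst.
  by apply: cvgMl_tmp; exact: cvg_harmonic.
have x1 : 0 < x + 1 by lra.
have := gauss_rgamma_cvg (x + 1) x1; rewrite -(cvg_shiftS (gauss_rgamma (x + 1))).
suff -> : [sequence gauss_rgamma (x + 1) n.+1]_n =
    (fun n => gauss_rgamma x n.+1 * ((1 + (x + 1) * harmonic n) / x)).
  by move=> h'; have := cvg_unique _ h' h => ->//; rewrite mulr0 addr0 mul1r.
apply/funext => n; rewrite /gauss_rgamma /= /harmonic /=.
rewrite powRD; last by rewrite pnatr_eq0 implybT.
rewrite powRr1//.
have -> : pochhammer (x + 1) n.+2 = pochhammer x n.+2 * (x + n.+2%:R) / x.
  rewrite /pochhammer [in RHS]big_ord_recl /= big_ord_recr /= addr0.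
  under eq_bigr do rewrite -addrA nat1r.
  rewrite -[x + 1 + _]addrA nat1r mulrC; field; rewrite gt_eqF//.
have s0 : n.+1%:R != 0 :> R by rewrite pnatr_eq0.
have f0 : (n.+1)`!%:R != 0 :> R by rewrite pnatr_eq0 -lt0n fact_gt0.
have p0 : n.+1%:R `^ x != 0 by rewrite gt_eqF// powR_gt0// ltr0n.
rewrite -[n.+2%:R]natr1; field.
by rewrite ?s0 ?f0 ?p0 ?gt_eqF.
Qed.

Lemma rgammaD (x : R) m : 0 < x -> rgamma (x + m%:R) = rgamma x / pochhammer x m.
Proof.
move=> x0; elim: m => [|m IH]; first by rewrite addr0 /pochhammer big_ord0 divr1.
have xm : 0 < x + m%:R by rewrite ltr_wpDr.
by rewrite -natr1 addrA rgammaS// IH pochhammerS invfM mulrA.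
Qed.

End ReciprocalGamma.

(** * The Bessel series, its differential equation and the wave [g] *)

Section Bessel.
Context {R : realType} (nu : R).
Hypothesis hnu : `|nu| < 2^-1.

Let nu_gt : - 2^-1 < nu. Proof. by move: hnu; rewrite ltr_norml => /andP[]. Qed.

Let nu1_gt0 : 0 < nu + 1. Proof. by have := nu_gt; lra. Qed.

Let nu1_ge : 2^-1 <= nu + 1. Proof. by have := nu_gt; lra. Qed.

(** Coefficients in the variable w = (z/2)^2, which makes the even series of [besselJJ] an ordinary
    [pseries]. *)
Definition bessel_coeff m : R := (-1) ^+ m / (m`!%:R * pochhammer (nu + 1) m).

Lemma bessel_coeff_dominated : exp_dominated bessel_coeff.
Proof.
(* As nu + 1 >= 1/2, each Pochhammer factor is at least 1/2, whence A = 2. *)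
exists 1, 2; split=> // n; rewrite mul1r /bessel_coeff normrM normrX normrN1 expr1n mul1r.
have f0 : 0 < n`!%:R :> R by rewrite ltr0n fact_gt0.
have p0 : 0 < pochhammer (nu + 1) n by exact: pochhammer_gt0.
rewrite ger0_norm; last by rewrite invr_ge0 mulr_ge0// ltW.
rewrite invfM mulrC ler_wpM2r ?invr_ge0 ?(ltW f0)//.
have -> : 2 ^+ n = (2^-1 ^+ n)^-1 :> R by rewrite exprVn invrK.
rewrite lef_pV2 ?posrE ?exprn_gt0//; exact: pochhammer_ge.
Qed.

(** The hypergeometric function 0F1(; nu+1; -w), followed by its first two derivatives. *)
Definition besselF (w : R) := limn (pseries bessel_coeff w).
Definition besselF1 (w : R) := limn (pseries (pseries_diffs bessel_coeff) w).
Definition besselF2 (w : R) :=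
  limn (pseries (pseries_diffs (pseries_diffs bessel_coeff)) w).

Lemma is_derive_besselF (w : R) : is_derive w 1 besselF (besselF1 w).
Proof. exact: exp_dominated_derive bessel_coeff_dominated. Qed.

Lemma is_derive_besselF1 (w : R) : is_derive w 1 besselF1 (besselF2 w).
Proof. exact: exp_dominated_derive (exp_dominated_diffs _ bessel_coeff_dominated). Qed.

(** The coefficient recursion (i+1)(nu+1+i) c_(i+1) = - c_i makes the combined partial sums vanish
    identically, so their limit is 0. *)
Lemma besselF_ode (w : R) : w * besselF2 w + (nu + 1) * besselF1 w + besselF w = 0.
Proof.
set c := bessel_coeff; set d := pseries_diffs c.
have dc : exp_dominated c := bessel_coeff_dominated.
have dd : exp_dominated d := exp_dominated_diffs _ dc.
have h0 := exp_dominated_cvg _ w dc; have h1 := exp_dominated_cvg _ w dd.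
have h2 := pseries_diffs_equiv (exp_dominated_cvg _ w (exp_dominated_diffs _ dd)).
have lhs : (fun n => w * (series (fun i => i%:R * d i * w ^+ i.-1) n)
   + (nu + 1) * pseries d w n + pseries c w n) @ \oo -->
   w * besselF2 w + (nu + 1) * besselF1 w + besselF w.
  apply: cvgD; last exact: h0.
  by apply: cvgD; [apply: cvgMl_tmp; exact: h2 | apply: cvgMl_tmp; exact: h1].
have Z : (fun n => w * (series (fun i => i%:R * d i * w ^+ i.-1) n)
   + (nu + 1) * pseries d w n + pseries c w n) = cst 0.
  apply/funext => n; rewrite /pseries /series /=.
  rewrite !mulr_sumr -!big_split /= big1// => i _.
  have -> : w * (i%:R * d i * w ^+ i.-1) = i%:R * d i * w ^+ i.
    by case: i => [|i]; rewrite ?mul0r ?mulr0// exprS /=; ring.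
  rewrite mulrA -!mulrDl (_ : _ + c i = 0) ?mul0r//.
  rewrite /d /pseries_diffs /c /bessel_coeff pochhammerS factS natrM exprS -natr1.
  have f0 : i`!%:R != 0 :> R by rewrite pnatr_eq0 -lt0n fact_gt0.
  have s0 : i%:R + 1 != 0 :> R by rewrite natr1 pnatr_eq0.
  have p0 : pochhammer (nu + 1) i != 0 by rewrite gt_eqF// pochhammer_gt0.
  have q0 : nu + 1 + i%:R != 0 by rewrite gt_eqF// ltr_wpDr.
  by field; rewrite f0 s0 p0 q0.
by rewrite Z in lhs; rewrite -(cvg_lim _ lhs)// lim_cst.
Qed.

Lemma besselJJE z : besselJJ nu z = besselF ((z / 2) ^+ 2).
Proof.
rewrite /besselJJ /besselF; congr (limn (series _)); apply/funext => m.
by rewrite /bessel_coeff /= -exprM mul2n; ring.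
Qed.

(** By [rgammaD], the factor [rgamma (nu + 1)] comes out of every term; for x > 0 so does the real
    power (x/2)^nu. *)
Lemma besselJE (x : R) : 0 < x ->
  besselJ nu x = rgamma (nu + 1) * (x / 2) `^ nu * besselJJ nu x.
Proof.
move=> x0; rewrite besselJJE /besselF.
have cv := exp_dominated_cvg _ ((x / 2) ^+ 2) bessel_coeff_dominated.
apply: etrans (lim_seriesZ (rgamma (nu + 1) * (x / 2) `^ nu) cv).
rewrite /besselJ; congr (limn (series _)); apply/funext => m.
rewrite addrAC rgammaD//.
have x2 : 0 < x / 2 by lra.
rewrite powRD; last by rewrite (gt_eqF x2) implybT.
rewrite powR_mulrn ?ltW// fctE /GRing.scale /= /bessel_coeff -exprM mul2n.
have f0 : m`!%:R != 0 :> R by rewrite pnatr_eq0 -lt0n fact_gt0.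
have p0 : pochhammer (nu + 1) m != 0 by rewrite gt_eqF// pochhammer_gt0.
by field; rewrite f0 p0.
Qed.

(** For z, t > 0 this is a constant multiple of sqrt(t) J_nu(z t), the form in which Bessel's
    equation has no first-order term. *)
Definition bessel_wave (z t : R) := t `^ (nu + 2^-1) * besselJJ nu (z * t).

Definition bessel_wave1 (z t : R) := t `^ (nu + 2^-1) *
  ((nu + 2^-1) / t * besselF ((z / 2) ^+ 2 * t ^+ 2) +
   2 * (z / 2) ^+ 2 * t * besselF1 ((z / 2) ^+ 2 * t ^+ 2)).

Lemma bessel_waveE z t :
  bessel_wave z t = t `^ (nu + 2^-1) * besselF ((z / 2) ^+ 2 * t ^+ 2).
Proof. by rewrite /bessel_wave besselJJE; congr (_ * besselF _); field. Qed.

Lemma bessel_wave_sturm z : sturm_solution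
  (fun t => z ^+ 2 + (4^-1 - nu ^+ 2) / t ^+ 2) (bessel_wave z) (bessel_wave1 z).
Proof.
move=> t t0; set p := nu + 2^-1; set k := (z / 2) ^+ 2.
have tn : t != 0 by rewrite gt_eqF.
have dp : is_derive t 1 (@powR R ^~ p) (p * t `^ p / t).
  apply: is_derive_eq (is_derive1_powR p t0) _.
  by rewrite powRB ?(negbTE tn) ?implybT// powRr1 ?ltW// mulrA.
have dk : is_derive t 1 (fun s : R => k * s ^+ 2) (2 * k * t).
  by apply: is_derive_eq; rewrite /GRing.scale /=; ring.
have dF : is_derive t 1 (fun s : R => besselF (k * s ^+ 2))
    (besselF1 (k * t ^+ 2) * (2 * k * t)).
  exact: (is_derive1_comp (g := fun s : R => k * s ^+ 2)) (is_derive_besselF _) dk.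
have dF1 : is_derive t 1 (fun s : R => besselF1 (k * s ^+ 2))
    (besselF2 (k * t ^+ 2) * (2 * k * t)).
  exact: (is_derive1_comp (g := fun s : R => k * s ^+ 2)) (is_derive_besselF1 _) dk.
have dV : is_derive t 1 (fun s : R => s^-1) (- t ^- 2).
  apply: is_derive_eq (is_deriveV tn (is_derive_id t 1)) _.
  by rewrite /GRing.scale /= mulr1.
split.
  rewrite (_ : bessel_wave z = fun s : R => s `^ p * besselF (k * s ^+ 2)); last first.
    by apply/funext => s; rewrite bessel_waveE.
  apply: is_derive_eq; rewrite /bessel_wave1 -/p -/k /GRing.scale /=.
  by field.
rewrite /bessel_wave1 -/p -/k bessel_waveE -/p -/k.
apply: is_derive_eq; rewrite /GRing.scale /=.
have := besselF_ode (k * t ^+ 2).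
move: (besselF _) (besselF1 _) (besselF2 _) => F F1 F2 /eqP.
rewrite addr_eq0 => /eqP ode.
(* Eliminating [F] through its equation leaves an identity that is polynomial in [F1] and [F2] and
   rational in t. *)
have {ode} FE : F = - (k * t ^+ 2 * F2 + (nu + 1) * F1) by rewrite ode opprK.
have zk : z ^+ 2 = 4 * k by rewrite /k; field.
rewrite zk /p; move: (t `^ _) => T.
by rewrite FE; field.
Qed.

Lemma besselJJ_continuous : continuous (@besselJJ R nu).
Proof.
rewrite (_ : @besselJJ R nu = besselF \o (fun z => (z / 2) ^+ 2)); last first.
  by apply/funext => z; rewrite besselJJE.
move=> z; apply: continuous_comp; last exact: is_derive1_continuous (is_derive_besselF _).
apply: is_derive1_continuous (2 / 2 * (z / 2)) _.
by apply: is_derive_eq; rewrite /GRing.scale /=; field.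
Qed.

Lemma besselJJ0 : besselJJ nu 0 = 1.
Proof.
rewrite besselJJE mul0r expr0n /= /besselF.
suff : pseries bessel_coeff 0 @ \oo --> (1 : R) by move/cvg_lim; apply.
rewrite -cvg_shiftS [X in X @ _](_ : _ = cst 1); first exact: cvg_cst.
apply/funext => n; rewrite /pseries /series /= big_nat_recl//= big1 => [|k _].
  by rewrite addr0 /bessel_coeff /pochhammer big_ord0 expr0 fact0 !mulr1 divr1.
by rewrite expr0n mulr0.
Qed.

Lemma bessel_wave_measurable z (D : set R) : measurable D ->
  measurable_fun D (bessel_wave z).
Proof.
move=> mD; apply: measurable_funM.
  by apply: measurable_funTS; exact: measurable_powR.
apply: measurable_funTS; apply: continuous_measurable_fun => t.
apply: continuous_comp; last exact: besselJJ_continuous.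
by apply: continuousM; [exact: cvg_cst|exact: cvg_id].
Qed.

(* The junk value of [powR] on the negative axis is [1], so the wave is bounded
   to the left of [0] as well. *)
Lemma bessel_wave_bounded z u : [bounded bessel_wave z t | t in `[-1, u]].
Proof.
have [M M0 bM] : exists2 M : R, 0 <= M &
    forall t, t \in `[-1, u] -> `|besselJJ nu (z * t)| <= M.
  have : bounded_set ((fun t => besselJJ nu (z * t)) @` `[-1, u]).
    apply: compact_bounded; apply: continuous_compact; last exact: segment_compact.
    apply: continuous_in_subspaceT => t _.
    apply: continuous_comp; last exact: besselJJ_continuous.
    by apply: continuousM; [exact: cvg_cst|exact: cvg_id].
  move=> [M [_ bM]]; exists (`|M| + 1); first by rewrite addr_ge0.
  move=> t tu; apply: (bM (`|M| + 1)); first by rewrite ltr_pwDr// ler_norm.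
  by exists t.
exists ((1 + `|u| `^ (nu + 2^-1)) * M); split; first exact: num_real.
move=> K ltK t /=; rewrite in_itv /= => tu; apply: le_trans (ltW ltK).
rewrite normrM; apply: ler_pM => //; last by apply: bM; rewrite in_itv.
have [t0|t0] := ltP t 0; first by rewrite lt0_powR1// normr1 lerDl powR_ge0.
rewrite norm_powR// ler_wpDl// ge0_ler_powR// ?nnegrE//; first by have := nu_gt; lra.
by rewrite ger0_norm//; case/andP: tu => _ tu; rewrite (le_trans tu)// ler_norm.
Qed.

Lemma bessel_wave_integrable z u :
  lebesgue_measure.-integrable `[-1, u] (EFin \o bessel_wave z).
Proof.
apply: measurable_bounded_integrable => //.
- by rewrite /= lebesgue_measure_itv /=; case: ifP; rewrite -?EFinD ltry.
- exact: bessel_wave_measurable.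
- exact: bessel_wave_bounded.
Qed.

(** A primitive of the wave. The base point -1 makes 0 an interior point, so that continuity at 0 is
    two-sided. *)
Definition bessel_area (z x : R) :=
  (\int[lebesgue_measure]_(t in `[-1, x]) bessel_wave z t)%R.

Lemma is_derive_bessel_area z (x : R) : 0 < x ->
  is_derive x 1 (bessel_area z) (bessel_wave z x).
Proof.
move=> x0; have xx1 : x < x + 1 by rewrite ltrDl.
have [||dG GE] := continuous_FTC1_closed xx1 (bessel_wave_integrable z (x + 1)).
- by apply: lt_trans x0; rewrite ltrN10.
- exact: sturm_continuous (bessel_wave_sturm z) x x0.
by apply: DeriveDef dG _; rewrite -derive1E.
Qed.

Lemma bessel_area_continuous z (x : R) : 0 <= x -> {for x, continuous (bessel_area z)}.
Proof.
move=> x0; have ix := bessel_wave_integrable z (x + 1).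
have le : -1 <= x + 1 by lra.
have := parameterized_integral_continuous le ix.
move=> /(continuous_subspaceW (@subset_itv_oo_cc _ _ (-1) (x + 1))).
rewrite continuous_open_subspace => [|]; last exact: interval_open.
by move=> /(_ x); apply; rewrite inE /= in_itv /=; lra.
Qed.

End Bessel.

(* Otherwise [J_nu] would vanish identically and would have no least positive
   zero. *)
Lemma rgamma_neq0 {R : realType} (nu : R) (hnu : `|nu| < 2^-1) (j : nat -> R) :
  ascending_positive_zeros (besselJ nu) j -> rgamma (nu + 1) != 0.
Proof.
move=> [jincr jE]; apply/eqP => rg0.
have [_ /(_ (ex_intro2 _ _ 1%N isT erefl))[j1 _]] := jE (j 1%N).
have j2 : 0 < j 1%N / 2 by rewrite divr_gt0.
have J0 : besselJ nu (j 1%N / 2) = 0 by rewrite besselJE// rg0 !mul0r.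
have [n n1 jn] := (jE (j 1%N / 2)).1 (conj j2 J0).
have : j 1%N <= j n.
  case: n n1 jn => [//|[|n]] _ _; first exact: lexx.
  by apply: ltW; apply: jincr.
by rewrite jn; lra.
Qed.

Lemma besselJ_eq0 {R : realType} (nu : R) (hnu : `|nu| < 2^-1) (x : R) :
  rgamma (nu + 1) != 0 -> 0 < x -> (besselJ nu x == 0) = (besselJJ nu x == 0).
Proof.
move=> rg x0; rewrite besselJE// !mulf_eq0 (negbTE rg) /=.
by rewrite gt_eqF// powR_gt0// divr_gt0.
Qed.

(** * Alternating sums of half-wave integrals weighted by [f] *)

Section WeightedHalfWaves.
Context {R : realType} {Q g g1 G f : R -> R}.
Notation mu := lebesgue_measure.
Hypothesis sol : sturm_solution Q g g1.
Hypothesis Q_gt0 : forall x : R, 0 < x -> 0 < Q x.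
Hypothesis Q_decr : forall x y : R, 0 < x -> x < y -> Q y < Q x.
Hypothesis dG : forall x : R, 0 < x -> is_derive x 1 G (g x).
Hypothesis cG : forall x : R, 0 <= x -> {for x, continuous G}.
Hypothesis ig : mu.-integrable `]0, 1[ (EFin \o g).
Hypothesis gG : forall c d : R, 0 <= c -> c <= d -> d <= 1 ->
  (\int[mu]_(t in `]c, d[) g t)%R = G d - G c.
Hypothesis f_pos : forall t : R, 0 < t < 1 -> 0 < f t.
Hypothesis f_incr : forall s t : R, 0 < s -> s <= t -> t < 1 -> f s <= f t.
Hypothesis ifg : mu.-integrable `]0, 1[ (EFin \o (fun t => f t * g t)).

Let I (c d : R) : R := (\int[mu]_(t in `]c, d[) (f t * g t))%R.

Let integrable_sub (h : R -> R) c d : 0 <= c -> d <= 1 ->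
  mu.-integrable `]0, 1[ (EFin \o h) -> mu.-integrable `]c, d[ (EFin \o h).
Proof.
move=> c0 d1; apply: integrableS => //.
by apply: subset_itv; rewrite bnd_simp.
Qed.

(** Here [s] stands for the sign of [g] on the interval: once s g >= 0, the weight [f] may be
    replaced by its bound [K]. *)
Lemma weighted_le (s K c d : R) : 0 <= c -> c <= d -> d <= 1 ->
  (forall x, c < x < d -> 0 <= s * g x) -> (forall x, c < x < d -> f x <= K) ->
  s * I c d <= K * (s * (G d - G c)).
Proof.
move=> c0 cd d1 gs fK; have ig' := integrable_sub g c d c0 d1 ig.
have ifg' := integrable_sub _ c d c0 d1 ifg.
rewrite -gG// mulrA /I -!RintegralZl//; apply: le_Rintegral => //.
- by apply: (integrableZl _ s ifg').
- by apply: (integrableZl _ (K * s) ig').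
move=> x /=; rewrite in_itv /= => xcd; rewrite mulrCA -mulrA.
by rewrite ler_wpM2r ?gs ?fK.
Qed.

Lemma weighted_ge (s K c d : R) : 0 <= c -> c <= d -> d <= 1 ->
  (forall x, c < x < d -> 0 <= s * g x) -> (forall x, c < x < d -> K <= f x) ->
  K * (s * (G d - G c)) <= s * I c d.
Proof.
move=> c0 cd d1 gs fK; have ig' := integrable_sub g c d c0 d1 ig.
have ifg' := integrable_sub _ c d c0 d1 ifg.
rewrite -gG// mulrA /I -!RintegralZl//; apply: le_Rintegral => //.
- by apply: (integrableZl _ (K * s) ig').
- by apply: (integrableZl _ s ifg').
move=> x /=; rewrite in_itv /= => xcd; rewrite [leRHS]mulrCA -mulrA.
by rewrite ler_wpM2r ?gs ?fK.
Qed.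

Lemma weighted_split (a b : R) : 0 < a -> a < b -> b <= 1 -> I 0 b = I 0 a + I a b.
Proof.
move=> a0 ab b1; have i1 := integrable_sub _ 0 a (lexx 0) (ltW (lt_le_trans ab b1)) ifg.
have i2 := integrable_sub _ 0 b (lexx 0) b1 ifg.
rewrite /I -(Rintegral_itvB (x := a) i2) ?bnd_simp// ?ltW//.
by rewrite (Rintegral_itv_bndo_bndc i1) addrC subrK.
Qed.

Variable t : nat -> R.
Hypothesis t0 : t 0%N = 0.
Hypothesis t_incr : forall k, t k < t k.+1.
Hypothesis g_zero : forall k, g (t k.+1) = 0.
Hypothesis g_neq0 : forall k x, t k < x < t k.+1 -> g x != 0.
Hypothesis g_pos : forall x, 0 < x < t 1%N -> 0 < g x.

Let tS_gt0 k : 0 < t k.+1.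
Proof. by elim: k => [|k IH]; [rewrite -t0 | apply: lt_trans IH _]. Qed.

Let t_ge0 k : 0 <= t k.
Proof. by case: k => [|k]; [rewrite t0 | exact: ltW]. Qed.

Let t_lt k l : (k < l)%N -> t k < t l.
Proof. by apply: (homo_ltn lt_trans). Qed.

(** Induction on k: a positive half-wave reaches its right end with negative slope, so the next one
    is negative. *)
Lemma half_wave_sign k x : t k < x < t k.+1 -> 0 < (-1) ^+ k * g x.
Proof.
elim: k x => [|k IH] x; first by rewrite t0 expr0 mul1r; exact: g_pos.
have solk := sturm_solutionZ ((-1) ^+ k) sol.
move=> xk; rewrite exprS mulN1r mulNr oppr_gt0.
apply: (sturm_sign_lt0 solk (t k.+1) (t k.+2)) => //.
- by rewrite g_zero mulr0.
- apply: (sturm_slope_lt0 solk Q_gt0 (t k)) => //.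
  by rewrite g_zero mulr0.
- by move=> y yk; rewrite mulf_neq0 ?signr_eq0// (g_neq0 k.+1).
Qed.

(** The terms in G(t_(k+1)) cancel, which leaves [sturm_area] for (-1)^k g. *)
Lemma half_wave_area_lt k :
  (-1) ^+ k * (G (t k.+1) - G (t k)) < (-1) ^+ k.+1 * (G (t k.+2) - G (t k.+1)).
Proof.
have solk := sturm_solutionZ ((-1) ^+ k) sol.
suff : (-1) ^+ k * G (t k.+2) < (-1) ^+ k * G (t k) by rewrite exprS mulN1r; lra.
apply: (sturm_area solk Q_gt0 Q_decr (fun x => (-1) ^+ k * G x) _ (t k.+1)) => //.
- by move=> x x0; apply: (is_deriveZ ((-1) ^+ k)); exact: dG.
- by move=> x x0; apply: continuousM; [exact: cvg_cst | exact: cG].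
- by rewrite g_zero mulr0.
- by rewrite g_zero mulr0.
- exact: half_wave_sign.
- by move=> x /half_wave_sign; rewrite exprS mulN1r mulNr oppr_gt0.
Qed.

Lemma weighted_half_waves_sign m : t m.+1 = 1 -> 0 < (-1) ^+ m * I 0 1.
Proof.
move=> tm.
(* The induction also bounds the partial sum by the last half-wave's area times the value of [f] at
   its right end. This bound stops at k < m, since t_(m+1) = 1 and [f] is controlled only inside (0,
   1). *)
suff main k : (k <= m)%N -> 0 < (-1) ^+ k * I 0 (t k.+1) /\
    ((k < m)%N -> (-1) ^+ k * I 0 (t k.+1) <=
                 f (t k.+1) * ((-1) ^+ k * (G (t k.+1) - G (t k)))).
  by case: (main m (leqnn m)) => + _; rewrite tm.
have t_le1 l : (l <= m)%N -> t l.+1 <= 1.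
  rewrite leq_eqVlt => /orP[/eqP ->|lm]; first by rewrite tm.
  by rewrite -tm ltW// t_lt.
have t_lt1 l : (l < m)%N -> t l.+1 < 1 by move=> lm; rewrite -tm t_lt.
have upper l : (l < m)%N -> (-1) ^+ l * I (t l) (t l.+1) <=
    f (t l.+1) * ((-1) ^+ l * (G (t l.+1) - G (t l))).
  move=> lm; apply: weighted_le => //; [exact: ltW|exact/ltW/t_lt1| |].
  - by move=> x /half_wave_sign/ltW.
  - move=> x /andP[lx xl]; apply: f_incr; [|exact: ltW|exact: t_lt1].
    exact: le_lt_trans lx.
elim: k => [|k IH] km.
  split; last by move=> m0; have := upper 0%N m0; rewrite t0.
  (* Cutting the first half-wave at its midpoint [h] yields the positive lower bound f h for the
     weight on the right half; [f] has no such bound near 0. *)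
  rewrite expr0 mul1r; have t1 := tS_gt0 0; set h := t 1%N / 2.
  have h0 : 0 < h by rewrite divr_gt0.
  have ht : h < t 1%N by rewrite /h; lra.
  have t11 := t_le1 0%N km.
  rewrite (weighted_split h (t 1%N))// ltr_wpDl//.
    apply: Rintegral_ge0 => x /=; rewrite in_itv /= => /andP[x0 xh].
    by apply: mulr_ge0; apply: ltW; [apply: f_pos|apply: g_pos]; lra.
  rewrite -[I _ _]mul1r; apply: (@lt_le_trans _ _ (f h * (1 * (G (t 1%N) - G h)))).
    rewrite mul1r mulr_gt0//; first by apply: f_pos; lra.
    rewrite subr_gt0; apply: (is_derive_gt0_lt g ht).
    - by move=> x x_; apply: dG; lra.
    - by move=> x x_; apply: cG; lra.
    - by move=> x x_; apply: g_pos; lra.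
  apply: weighted_ge => //; [exact: ltW|exact: ltW| |].
  - by move=> x x_; rewrite mul1r ltW// g_pos//; lra.
  - by move=> x x_; apply: f_incr; lra.
have [Sk /(_ km) Sk_le] := IH (ltnW km).
have spl : (-1) ^+ k.+1 * I 0 (t k.+2) =
    (-1) ^+ k.+1 * I (t k.+1) (t k.+2) - (-1) ^+ k * I 0 (t k.+1).
  by rewrite (weighted_split (t k.+1) (t k.+2))// ?t_le1// exprS; ring.
rewrite spl; split.
  (* With A_k the area of half-wave k: the old sum is at most f(t_(k+1)) A_k < f(t_(k+1)) A_(k+1),
     which is at most the new weighted half-wave. *)
  rewrite subr_gt0; apply: le_lt_trans Sk_le _.
  apply: (@lt_le_trans _ _ (f (t k.+1) * ((-1) ^+ k.+1 * (G (t k.+2) - G (t k.+1))))).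
    rewrite ltr_pM2l ?half_wave_area_lt// f_pos// tS_gt0 /=; exact: t_lt1.
  apply: weighted_ge; [exact: ltW|exact/ltW/t_lt|exact: t_le1| |].
  - by move=> x /half_wave_sign/ltW.
  - move=> x /andP[kx xk]; apply: f_incr => //; first exact: ltW.
    by apply: lt_le_trans xk _; exact: t_le1.
(* The old sum is positive, so subtracting it keeps the new sum below its last term. *)
move=> km'; apply: le_trans (upper k.+1 km'); rewrite gerBl; exact: ltW.
Qed.

End WeightedHalfWaves.

(** * The zeros of J_nu, rescaled, as ends of the half-waves *)

Theorem lemma6p1 (R : realType) (nu : R) (hnu : `|nu| < 2^-1)
    (j : nat -> R) (hj : ascending_positive_zeros (besselJ nu) j)
    (f : R -> R)
    (f_pos : forall t : R, 0 < t < 1 -> 0 < f t)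
    (f_incr : forall s t : R, 0 < s -> s <= t -> t < 1 -> f s <= f t)
    (f_int : lebesgue_measure.-integrable `]0, 1[ (EFin \o f))
    (m : nat) (hm : (1 <= m)%N) :
  Num.sg (hankelH nu f (j m)) = (-1) ^+ m.+1.
Proof.
case: m hm => // m _; have rg := rgamma_neq0 nu hnu j hj.
have [j_incr jE] := hj.
have j_gt0 k : 0 < j k.+1.
  by have [_ /(_ (ex_intro2 _ _ k.+1 isT erefl))[]] := jE (j k.+1).
have j_zero k : besselJJ nu (j k.+1) = 0.
  have [_ /(_ (ex_intro2 _ _ k.+1 isT erefl))[_ /eqP]] := jE (j k.+1).
  by rewrite besselJ_eq0// => /eqP.
have j_lt k l : (k < l)%N -> j k.+1 < j l.+1 by move=> kl; exact: j_incr.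
(* The value at index 0 is reset to 0, the left end of the first half-wave. *)
pose i k := if k is k'.+1 then j k else 0.
have i_incr k : i k < i k.+1 by case: k => [|k] //=; exact: j_lt.
have i_lt k l : (k < l)%N -> i k < i l by exact: (homo_ltn lt_trans).
have i_le k l : (k <= l)%N -> i k <= i l.
  by rewrite leq_eqVlt => /orP[/eqP -> //|kl]; rewrite ltW// i_lt.
have i_neq0 k x : i k < x < i k.+1 -> besselJJ nu x != 0.
  move=> /andP[kx xk]; have x0 : 0 < x.
    by apply: le_lt_trans kx; case: k {xk} => [|k] //=; exact: ltW.
  rewrite -besselJ_eq0//; apply/eqP => Jx.
  have [[//|l] _ jl] := (jE x).1 (conj x0 Jx).
  have [kl|lk] := leqP k l.
    by have := i_le k.+1 l.+1 kl; rewrite /= jl leNgt xk.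
  have := i_le l.+1 k lk.
  by rewrite /= jl leNgt kx.
(* [besselJJ] equals 1 at 0 and cannot change sign before its first positive zero. *)
have i_pos x : 0 < x < i 1%N -> 0 < besselJJ nu x.
  move=> /andP[x0 x1]; rewrite ltNge; apply/negP => Jx.
  have cJ : {within `[0, x], continuous (@besselJJ R nu)}.
    by apply: continuous_in_subspaceT => y _; exact: besselJJ_continuous.
  have [|y] := IVT (v := 0) (ltW x0) cJ.
    by rewrite besselJJ0 ge_min Jx orbT le_max ler01.
  rewrite in_itv /= => /andP[]; rewrite le_eqVlt => /orP[/eqP <- _|y0 yx /eqP].
    by rewrite besselJJ0 => /eqP; rewrite oner_eq0.
  by apply/negP; apply: (i_neq0 0%N); rewrite /= y0 (le_lt_trans yx).
pose z := j m.+1; have z0 : 0 < z by exact: j_gt0.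
have wave_eq0 x : 0 < x -> (bessel_wave nu z x == 0) = (besselJJ nu (z * x) == 0).
  by move=> x0; rewrite mulf_eq0 gt_eqF// powR_gt0.
have ig u := bessel_wave_integrable nu hnu z u.
have sub01 : `]0, 1[ `<=` `[-1, 1 : R] by apply: subset_itv; rewrite bnd_simp//; lra.
have ig01 : lebesgue_measure.-integrable `]0, 1[ (EFin \o bessel_wave nu z).
  exact: integrableS (ig 1).
have hankelE : hankelH nu f z =
    (\int[lebesgue_measure]_(t in `]0, 1[) (f t * bessel_wave nu z t))%R.
  by apply: eq_Rintegral => x _; rewrite /bessel_wave mulrCA mulrA mulrAC.
rewrite -/z hankelE.
(* The index was shifted by one, so the exponent in the goal is m + 2, of the parity of m. *)
suff : 0 < (-1) ^+ m *
    (\int[lebesgue_measure]_(t in `]0, 1[) (f t * bessel_wave nu z t))%R.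
  rewrite !exprS !mulN1r opprK -signr_odd; case: (odd m).
    by rewrite expr1 mulN1r oppr_gt0 => /ltr0_sg.
  by rewrite expr0 mul1r => /gtr0_sg.
(* Here |nu| < 1/2 makes the coefficient of 1/t^2 positive, hence Q positive and decreasing. *)
have qc : 0 < 4^-1 - nu ^+ 2 by move: hnu; rewrite ltr_norml => /andP[]; nra.
(* Division by [z] turns zeros of [besselJJ] into zeros of the wave and sends the last one, [z]
   itself, to 1. *)
apply: (weighted_half_waves_sign (bessel_wave_sturm nu hnu z) _ _ _ _ ig01 _ f_pos f_incr
  _ (fun k => i k / z) _ _ _ _ _ m).
- by move=> x x0; rewrite ltr_pwDl// ?exprn_gt0// divr_ge0 ?sqr_ge0 ?ltW.
- move=> x y x0 xy; have y0 := lt_trans x0 xy.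
  rewrite ltrD2l ltr_pM2l// ltf_pV2 ?posrE ?exprn_gt0//.
  by rewrite ltr_pXn2r// ?nnegrE ltW.
- by move=> x x0; exact: is_derive_bessel_area.
- by move=> x x0; exact: bessel_area_continuous.
- move=> c d c0 cd d1; rewrite /bessel_area.
  rewrite (Rintegral_itvB (ig d)) ?bnd_simp//; last by lra.
  rewrite (@Rintegral_itv_bndo_bndc _ (BRight c))//; apply: integrableS (ig d) => //.
  by apply: subset_itv; rewrite bnd_simp//; lra.
- apply: (integrableMl _ f_int) => //; first exact: bessel_wave_measurable.
  have [M [Mr bM]] := bessel_wave_bounded nu hnu z 1; exists M; split=> // K MK x x01.
  by apply: bM MK _ _; exact: sub01.
- by rewrite mul0r.
- by move=> k; rewrite ltr_pM2r ?invr_gt0.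
- move=> k; apply/eqP; rewrite wave_eq0 ?divr_gt0 ?j_gt0//.
  by rewrite mulrC divfK ?lt0r_neq0//; apply/eqP; exact: j_zero.
- move=> k x /andP[kx xk]; rewrite wave_eq0; last first.
    apply: le_lt_trans kx; rewrite divr_ge0 ?(ltW z0)//.
    by case: k {xk} => [|k] //=; exact: ltW.
  by rewrite (i_neq0 k)// mulrC -ltr_pdivrMr// kx -ltr_pdivlMr.
- move=> x /andP[x0 xk]; rewrite mulr_gt0 ?powR_gt0// i_pos// mulr_gt0//=.
  by rewrite mulrC -ltr_pdivlMr.
- by rewrite /= divff// gt_eqF.
Qed.
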